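(* Let $\alpha$ and $C>0$ be real numbers such that $1/2<\alpha<1$. Then for all sufficiently small $\epsilon>0$ there are (compact) metric measure spaces $X$ and $Y$ with $d_{GHP}(X,Y)\leq \epsilon$ for which there is a positive integer $N$ such that $$d_P(\theta^X_N,\theta^Y_N;d_\pi)>C\epsilon^\alpha.$$
   Context: A metric measure space is a triple $(X,d,\mu)$ with $(X,d)$ a compact metric space and $\mu$ a Borel probability measure on $X$. Prokhorov distance: let $\mu_1,\mu_2$ be Borel probability measures on a (pseudo-)metric space $(Z,d_Z)$. For a probability measure $\theta$ on $Z\times Z$ with marginals $\mu_1,\mu_2$ put $\Delta(\theta;d_Z)=\inf\{r>0:\theta(\{(z_1,z_2): d_Z(z_1,z_2)\le r\})\ge 1-r\}$, and let $d_P(\mu_1,\mu_2;d_Z)=\inf_\theta \Delta(\theta;d_Z)$ over all such $\theta$. Gromov-Hausdorff-Prokhorov distance: $d_{GHP}(X_1,X_2)=\inf d_P(\iota_{1*}\mu_1,\iota_{2*}\mu_2;d_Z)$, the infimum being over all compact metric spaces $Z$ and isometric (distance-preserving) embeddings $\iota_i:X_i\to Z$, $i=1,2$. Matrices: $M(N)$ is the space of real symmetric $N\times N$ matrices. For $A=(a_{ij}),B=(b_{ij})\in M(N)$, let $d_M(A,B)=\inf\{\rho>0:\exists\lambda\subset\{1,\dots,N\},\ |\lambda|<N\rho,\ |a_{ij}-b_{ij}|<\rho\ \forall i,j\notin\lambda\}$ (a pseudo-metric). The symmetric group $S_N$ acts on $M(N)$ by simultaneous permutation of rows and columns, and $d_\pi(A,B)=\min\{d_M(A,\pi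 B):\pi\in S_N\}$. $\mathbb{D}(N)\subset M(N)$ is the set of distance matrices (symmetric, non-negative entries, zero diagonal, $a_{ij}\le a_{ik}+a_{kj}$ for all $i,j,k$), with the restrictions of these pseudo-metrics; measures on $M(N)$, $\mathbb{D}(N)$ are Borel for the usual topology of matrices. For a metric measure space $(X,d,\mu)$ and $N\in\mathbb{N}$, $\theta_N^X$ is the distribution on $\mathbb{D}(N)$ of the random matrix $(d(x_i,x_j))_{1\le i,j\le N}$, where $x_1,\dots,x_N$ are sampled independently from $X$ according to $\mu$. *)

(* Defs.v *)
From HB Require Import structures.
From mathcomp Require Import all_boot all_order all_algebra all_fingroup.
From mathcomp Require Import all_classical all_reals all_analysis.
From mathcomp Require Import measurable_realfun lra.

Set Implicit Arguments.
Unset Strict Implicit.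
Unset Printing Implicit Defensive.

Import Order.TTheory GRing.Theory Num.Theory.
Import numFieldNormedType.Exports.

Local Open Scope classical_set_scope.
Local Open Scope ring_scope.

(* Measurable types are pointed in the library, so measures are put on pointed
   metric spaces.  The base point is never used, and it is no restriction: a
   space carrying a probability measure is nonempty. *)
#[short(type="pmetricType")]
HB.structure Definition PointedMetric (K : numDomainType) :=
  {M of Metric K M & isPointed M}.

Notation borel T := (g_sigma_algebraType (@open T)).

Section pushforward_probability.
Context {d d'} {T : measurableType d} {T' : measurableType d'} {R : realType}.

Definition push_prob (P : probability T R) (f : T -> T')
    (mf : measurable_fun [set: T] f) : probability T' R :=
  distribution P (mfun_Sub (mem_set mf)).

End pushforward_probability.

Section power_probability.
Context {d} {T : measurableType d} {R : realType} (P : probability T R).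
Local Open Scope ereal_scope.

Definition tuple_cons n (z : T * n.-tuple T) : n.+1.-tuple T :=
  [tuple of z.1 :: z.2].

Lemma measurable_tuple_cons n :
  measurable_fun [set: T * n.-tuple T] (@tuple_cons n).
Proof. exact: measurable_cons. Qed.

(* The product measure on n.-tuple T (see [power_prob_rect]), i.e., the joint
   law of n independent draws from P. *)
Fixpoint power_prob n : probability (n.-tuple T) R :=
  if n is m.+1 then push_prob (P \x power_prob m) (@measurable_tuple_cons m)
  else dirac [tuple].

Lemma power_prob_rect n (A : 'I_n -> set T) : (forall i, measurable (A i)) ->
  power_prob n [set t | forall i, A i (tnth t i)] = \prod_(i < n) P (A i).
Proof.
elim: n A => [|n IH] A mA.
  by rewrite big_ord0 /= diracE mem_set// => -[].
rewrite big_ord_recl -IH// -product_measure1E//; last first.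
  rewrite (_ : mkset _ = \bigcap_(i in [set: 'I_n])
      ((fun t : n.-tuple T => tnth t i) @^-1` A (lift ord0 i))); last first.
    by apply/seteqP; split => t /= h i; [move=> _; exact: h|exact: h].
  apply: fin_bigcap_measurable => // i _.
  by rewrite -[X in measurable X]setTI; exact: measurable_tnth.
transitivity ((P \x power_prob n)
  (@tuple_cons n @^-1` [set t | forall i, A i (tnth t i)])) => //.
congr (_ _).
apply/seteqP; split => [[x t] /= h|[x t] /= [hx ht] i].
  by split; [exact: (h ord0)|move=> i; have := h (lift ord0 i); rewrite tnthS].
by case: (unliftP ord0 i) => [j ->|->//]; rewrite tnthS.
Qed.

End power_probability.

Section prokhorov.
Context {d} {Z : measurableType d} {R : realType}.
Implicit Types (P Q : probability Z R) (dZ : Z -> Z -> R).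

Definition coupling P Q : set (probability (Z * Z)%type R) :=
  [set theta | forall A, measurable A ->
    theta (fst @^-1` A) = P A /\ theta (snd @^-1` A) = Q A].

(* Infima are taken in \bar R, where the infimum of the empty set is +oo. *)
Definition coupling_defect (theta : probability (Z * Z)%type R) dZ : \bar R :=
  ereal_inf [set r%:E | r in [set r : R | 0 < r /\
    ((1 - r)%:E <= theta [set z | (dZ z.1 z.2 <= r)%R])%E]].

Definition prokhorov P Q dZ : \bar R :=
  ereal_inf [set coupling_defect theta dZ | theta in coupling P Q].

End prokhorov.

Record mmspace (R : realType) := MMSpace {
  mm_space :> pmetricType R ;
  mm_compact : compact [set: mm_space] ;
  mm_prob : probability (borel mm_space) R }.

Record isometric_embedding (R : realType) (X Z : pmetricType R) :=
  IsometricEmbedding {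
    emb_fun :> X -> Z ;
    emb_mdist : forall x y, mdist (emb_fun x) (emb_fun y) = mdist x y }.

Section gromov_hausdorff_prokhorov.
Context {R : realType}.

Lemma measurable_embedding (X Z : pmetricType R)
  (f : isometric_embedding X Z) :
  measurable_fun [set: borel X] (f : borel X -> borel Z).
Proof.
apply: (@measurability _ _ (borel X) (borel Z) _ _ (@open Z)) => //.
move=> _ [U oU <-]; rewrite setTI.
apply: sub_sigma_algebra; move: U oU.
apply/continuousP => x; apply/metricType_numDomainType.cvgrPdist_lt => e e0.
near=> y; rewrite emb_mdist.
by near: y; exact: metricType_numDomainType.cvgr_dist_lt.
Unshelve. all: by end_near. Qed.

Definition dGHP (X1 X2 : mmspace R) : \bar R :=
  ereal_inf [set r | exists (Z : pmetricType R)
      (f1 : isometric_embedding X1 Z) (f2 : isometric_embedding X2 Z),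
    compact [set: Z] /\
    r = prokhorov (push_prob (mm_prob X1) (measurable_embedding f1))
          (push_prob (mm_prob X2) (measurable_embedding f2)) mdist].

End gromov_hausdorff_prokhorov.

Section matrices.
Context {R : realType} {N : nat}.
Implicit Types A B : 'M[R]_N.

(* For N = 0 the infimum is over the empty set, and [inf] returns 0; for N > 0
   the set contains every large enough rho (take l to be everything). *)
Definition dM A B : R :=
  inf [set rho | 0 < rho /\ exists l : {set 'I_N}, #|l|%:R < N%:R * rho /\
    forall i j, i \notin l -> j \notin l -> `|A i j - B i j| < rho].

Definition perm_rowcol (s : 'S_N) A : 'M[R]_N := row_perm s (col_perm s A).

(* The default value [dM A B] is the term of the identity permutation. *)
Definition dpi A B : R :=
  \big[Num.min/dM A B]_(s : 'S_N) dM A (perm_rowcol s B).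

Definition is_distmx A : Prop :=
  [/\ forall i j, A i j = A j i, forall i j, 0 <= A i j,
      forall i, A i i = 0 & forall i j k, A i j <= A i k + A k j].

Lemma is_distmx0 : is_distmx 0.
Proof. by split => [i j|i j|i|i j k]; rewrite !mxE ?addr0. Qed.

End matrices.

Definition distmx (R : realType) (N : nat) : Type :=
  set_type [set A : 'M[R]_N | is_distmx A].

Definition mk_distmx {R : realType} {N : nat} (A : 'M[R]_N)
  (dA : is_distmx A) : distmx R N := exist _ A (mem_set dA).

HB.instance Definition _ (R : realType) N := Topological.on (distmx R N).
HB.instance Definition _ (R : realType) N :=
  isPointed.Build (distmx R N) (mk_distmx is_distmx0).

Section sampling.
Context {R : realType}.

Lemma measurable_mdist (X : pmetricType R) : compact [set: X] ->
  measurable_fun [set: borel X * borel X] (fun z => mdist z.1 z.2 : R).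
Proof.
move=> /compact_second_countable[B cB [oB basB]].
apply: (measurability _ (RGenInftyO.measurableE R)) => _ [_ [r ->] <-].
rewrite setTI; set W := _ @^-1` _.
pose C := [set UV : set X * set X | (B `*` B) UV /\ UV.1 `*` UV.2 `<=` W].
have -> : W = \bigcup_(UV in C) (UV.1 `*` UV.2).
  apply/seteqP; split; last by move=> z [UV [_ UVW]]; exact: UVW.
  move=> [x y] xyr; rewrite /W /= in_itv/= in xyr.
  pose e := (r - mdist x y) / 2.
  have e0 : 0 < e by rewrite divr_gt0// subr_gt0.
  have [U [BU Ux] Ue] := basB x _ (nbhsx_ballx x e e0).
  have [V [BV Vy] Ve] := basB y _ (nbhsx_ballx y e e0).
  exists (U, V) => //; split => // -[x' y']/= [/Ue + /Ve].
  rewrite !ballEmdist/= => xx' yy'; rewrite /W/= in_itv/=.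
  rewrite (le_lt_trans (metric_triangle _ x _))// metric_sym.
  have := metric_triangle x y y'; rewrite /e in xx' yy'; lra.
rewrite bigcup_set_type; apply: countable_bigcupT_measurable.
  rewrite (eq_countable (card_setT _)).
  by apply: sub_countable (countableX cB cB); apply: subset_card_le => ? [].
move=> [[U V]/= /set_mem[[/= BU BV] _]].
by apply: measurableX; apply: sub_sigma_algebra; exact: oB.
Qed.

Lemma measurable_distmx {d} {T : measurableType d} N (f : T -> distmx R N) :
  (forall i j, measurable_fun [set: T] (fun t => val (f t) i j)) ->
  measurable_fun [set: T] (f : T -> borel (distmx R N)).
Proof.
move=> mf.
apply: (@measurability _ _ T (borel (distmx R N)) _ _ (@open (distmx R N))) => //.
move=> _ [_ [U oU <-] <-]; rewrite setTI.
pose box (q : 'M[rat]_N) (n : nat) : set 'M[R]_N :=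
  [set A | forall i j, `|A i j - ratr (q i j)| < n.+1%:R^-1].
pose C := [set qn : 'M[rat]_N * nat | box qn.1 qn.2 `<=` U].
have -> : f @^-1` (val @^-1` U) =
    \bigcup_(qn in C) [set t | box qn.1 qn.2 (val (f t))].
  apply/seteqP; split; last by move=> t [qn]; exact.
  move=> t /= Ut.
  have [e e0 eU] : exists2 e : R, 0 < e & ball (val (f t)) e `<=` U.
    by apply/nbhs_ballP; exact: open_nbhs_nbhs.
  have [n ne] : exists n, n.+1%:R^-1 < e / 2.
    have /ltr_add_invr[n] : 0 < e / 2 by rewrite divr_gt0.
    by rewrite add0r => ne; exists n.
  have [q qn] : exists q : 'M[rat]_N, box q n (val (f t)).
    have h i j : exists q : rat, `|val (f t) i j - ratr q| < n.+1%:R^-1.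
      have n0 : 0 < n.+1%:R^-1 :> R by [].
      have /rat_in_itvoo[q] : val (f t) i j < val (f t) i j + n.+1%:R^-1.
        by rewrite ltrDl.
      rewrite in_itv/= => /andP[h1 h2]; exists q.
      by rewrite distrC ger0_norm ?subr_ge0 ?(ltW h1)// ltrBlDl.
    exists (\matrix_(i, j) projT1 (cid (h i j))) => i j.
    by rewrite mxE; exact: (projT2 (cid (h i j))).
  exists (q, n) => // A qA; apply: eU; split => // i j.
  have := qn i j; have := qA i j; rewrite /ball/= => h1 h2.
  rewrite (le_lt_trans (ler_distD (ratr (q i j)) _ _))//.
  by rewrite (distrC (ratr _)) [ltRHS]splitr ltrD// (lt_trans _ ne).
rewrite bigcup_set_type; apply: countable_bigcupT_measurable.
  by rewrite (eq_countable (card_setT _)); exact: countableP.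
move=> [[q n]/= _].
rewrite (_ : mkset _ = \bigcap_(ij in [set: 'I_N * 'I_N])
  ((fun t => val (f t) ij.1 ij.2) @^-1`
    ball (ratr (q ij.1 ij.2) : R) n.+1%:R^-1)).
  apply: fin_bigcap_measurable => // -[i j] _.
  by rewrite -[X in measurable X]setTI; apply: mf => //;
    apply: open_measurable; exact: ball_open.
apply/seteqP; split => t /= h; first by move=> [i j] _ /=; rewrite /ball/= distrC.
by move=> i j; rewrite distrC; exact: (h (i, j)).
Qed.

Context (X : mmspace R) (N : nat).

Lemma is_distmx_sample (t : N.-tuple (borel X)) :
  is_distmx (\matrix_(i < N, j < N) (mdist (tnth t i : X) (tnth t j) : R)).
Proof.
split=> [i j|i j|i|i j k]; rewrite !mxE.
- exact: metric_sym.
- exact: mdist_ge0.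
- exact: mdistxx.
- exact: metric_triangle.
Qed.

Definition sample_distmx (t : N.-tuple (borel X)) : borel (distmx R N) :=
  mk_distmx (is_distmx_sample t).

Lemma measurable_sample_distmx :
  measurable_fun [set: N.-tuple (borel X)] sample_distmx.
Proof.
apply: measurable_distmx => i j; rewrite /sample_distmx/=.
rewrite (_ : (fun t => _) = (fun z : borel X * borel X => mdist z.1 z.2 : R) \o
    (fun t : N.-tuple (borel X) => (tnth t i, tnth t j))); last first.
  by apply/funext => t /=; rewrite mxE.
apply: (measurableT_comp (measurable_mdist (@mm_compact _ X))).
by apply: measurable_fun_pair; exact: measurable_tnth.
Qed.

Definition theta : probability (borel (distmx R N)) R :=
  push_prob (power_prob (mm_prob X) N) measurable_sample_distmx.

End sampling.

Definition dpi_distmx {R : realType} {N : nat} (A B : distmx R N) : R :=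
  dpi (val A) (val B).

(* Main.v *)
(* X and Y live on the two-point space of diameter 1: X is concentrated on one
   point, and Y gives mass eps to the other one, so they are eps-close.  An
   N-sample of X always gives the zero matrix.  With N of order eps^(-1/2), an
   N-sample of Y meets both points with probability of order N eps ~ eps^(1/2),
   and then its matrix is at distance at least 1 / N ~ eps^(1/2) from 0, because
   at distance less than 1 / N no index may be discarded.  Hence the Prokhorov
   distance is at least of order eps^(1/2), which exceeds C eps^alpha for small
   eps, as alpha > 1/2. *)

From HB Require Import structures.
Require Import Defs.
From mathcomp Require Import all_boot all_order all_algebra all_fingroup.
From mathcomp Require Import all_classical all_reals all_analysis.
From mathcomp Require Import measurable_realfun lra.

Import Order.TTheory GRing.Theory Num.Theory.
Import numFieldNormedType.Exports.

Local Open Scope classical_set_scope.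
Local Open Scope ring_scope.

(** * A lower bound for the Prokhorov distance *)

Section prokhorov_lower_bound.
Context {d} {Z : measurableType d} {R : realType}.

(* Sublevel sets have to be measurable: the value of a library probability on a
   non-measurable set is unconstrained. *)
Lemma prokhorov_ge (P Q : probability Z R) (dZ : Z -> Z -> R) (A B : set Z)
    (c : R) :
  (forall r, 0 < r -> measurable [set z : Z * Z | dZ z.1 z.2 <= r]) ->
  measurable A -> measurable B -> P (~` A) = 0%E -> (Q (~` B) <= (1 - c)%:E)%E ->
  (forall x y, A x -> B y -> c <= dZ x y) ->
  (c%:E <= prokhorov P Q dZ)%E.
Proof.
move=> mdZ mA mB PA QB AB; apply: le_ereal_inf_tmp => _ [th thPQ <-].
apply: le_ereal_inf_tmp => _ [r [r0 rth] <-]; rewrite lee_fin leNgt; apply/negP => rc.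
have [PE _] := thPQ (~` A) (measurableC mA).
have [_ QE] := thPQ (~` B) (measurableC mB).
have mA' : measurable (@fst Z Z @^-1` ~` A).
  by rewrite -[X in measurable X]setTI; apply: measurable_fst => //; exact: measurableC.
have mB' : measurable (@snd Z Z @^-1` ~` B).
  by rewrite -[X in measurable X]setTI; apply: measurable_snd => //; exact: measurableC.
(* As [r < c], no pair of the sublevel set lies in [A] times [B]. Hence its mass under the coupling
   is at most 0 + (1 - c) < 1 - r. *)
have : (th [set z | (dZ z.1 z.2 <= r)%R] <= th (fst @^-1` ~` A) + th (snd @^-1` ~` B))%E.
  apply: le_trans (measureU2 _ mA' mB').
  apply: le_measure; rewrite ?inE; [exact: mdZ|exact: measurableU|].
  move=> [x y] /= xyr; have [Ax|] := pselect (A x); last by left.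
  right => By; have := AB x y Ax By; lra.
rewrite PE QE PA add0e => /(le_trans rth)/le_trans/(_ QB).
by rewrite lee_fin; lra.
Qed.

End prokhorov_lower_bound.

(** * The matrix pseudo-metrics [dM] and [dpi] *)

Section dpi_theory.
Context {R : realType} {N : nat}.
Implicit Types (A B : 'M[R]_N) (r rho : R).

Definition dM_radii A B : set R := [set rho | 0 < rho /\
  exists l : {set 'I_N}, #|l|%:R < N%:R * rho /\
  forall i j, i \notin l -> j \notin l -> `|A i j - B i j| < rho].

Lemma dM_radii_nonempty A B : (0 < N)%N -> dM_radii A B !=set0.
Proof.
(* At radius 2 every index may be discarded, since N < 2 * N. *)
move=> N0; exists 2; split=> //; exists [set: 'I_N]%SET.
split; last by move=> i j; rewrite inE.
by rewrite cardsT card_ord mulr_natr mulr2n ltrDl ltr0n.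
Qed.

(** Radii are closed upwards, so the infimum is at most [r] exactly when all larger numbers are
    radii. Testing only [r + 1 / (n + 1)] keeps the condition countable, for use in
    [measurable_dpi_le]. *)
Lemma dM_leP A B r : (0 < N)%N -> 0 < r ->
  dM A B <= r <-> forall n, dM_radii A B (r + n.+1%:R^-1).
Proof.
move=> N0 r0; split=> [ABr n|ABr].
  have /(inf_lt (dM_radii_nonempty A B N0))[rho [rho0 [l [lrho Arho]]] rhor] :
      dM A B < r + n.+1%:R^-1 by rewrite (le_lt_trans ABr)// ltrDl.
  split; first by rewrite addr_gt0.
  exists l; split=> [|i j il jl]; last exact: lt_trans (Arho _ _ il jl) rhor.
  by rewrite (lt_trans lrho)// ltr_pM2l// ltr0n.
rewrite leNgt; apply/negP => /ltr_add_invr[n].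
rewrite ltNge => /negP; apply; apply: ge_inf (ABr n).
by exists 0 => x [/ltW].
Qed.

Lemma dpi_leP A B r :
  dpi A B <= r <-> exists s : 'S_N, dM A (perm_rowcol s B) <= r.
Proof.
split=> [/bigmin_leP[ABr|[s _ sr]]|[s sr]].
- exists 1%g; rewrite (_ : perm_rowcol _ _ = B)//.
  by apply/matrixP => i j; rewrite !mxE !perm1.
- by exists s.
- by rewrite (le_trans _ sr)//; exact: bigmin_le.
Qed.

Lemma dM0_ge B i j : 1 <= B i j -> N%:R^-1 <= dM 0 B.
Proof.
move=> B1; have N0 : (0 < N)%N by case: N i {j B1} B => // -[].
apply: lb_le_inf (dM_radii_nonempty _ _ N0) _ => rho [rho0 [l [lrho Brho]]].
rewrite leNgt; apply/negP => rhoN.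
have /cards0_eq l0 : #|l| = 0%N.
  apply/eqP; rewrite -leqn0 -ltnS -(ltr_nat R) (lt_trans lrho)//.
  by rewrite mulrC -ltr_pdivlMr ?ltr0n// div1r.
have := Brho i j; rewrite l0 !inE mxE sub0r normrN => /(_ isT isT).
apply/negP; rewrite -leNgt (le_trans (ltW rhoN))//.
rewrite (le_trans _ (le_trans B1 (ler_norm _)))//.
by rewrite invf_le1 ?ltr0n// ler1n.
Qed.

(** A permutation only moves the large entry of [B], so [dM0_ge] bounds every term of the
    minimum. *)
Lemma dpi0_ge B i j : 1 <= B i j -> N%:R^-1 <= dpi 0 B.
Proof.
move=> B1; apply: le_bigmin => [|s _]; first exact: (dM0_ge _ _ _ B1).
by apply: (dM0_ge _ (s^-1%g i) (s^-1%g j)); rewrite !mxE !permKV.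
Qed.

End dpi_theory.

(** * Measurability on the space of distance matrices *)

Section borel_distmx.
Context {R : realType} {N : nat}.

Definition distmx_coef (i j : 'I_N) (A : borel (distmx R N)) : R := val A i j.

Lemma measurable_distmx_coef (i j : 'I_N) :
  measurable_fun [set: borel (distmx R N)] (distmx_coef i j).
Proof.
apply: (measurability _ (RGenOpens.measurableE R)) => _ [_ [a [b ->]] <-].
rewrite setTI; apply: sub_sigma_algebra.
exists ((fun A : 'M[R]_N => A i j) @^-1` `]a, b[%classic) => //.
apply: open_comp => [A _|]; last exact: interval_open.
exact: coord_continuous.
Qed.

(** Provides the measurable sublevel sets required by [prokhorov_ge]. They arise from strict
    inequalities between matrix entries by finite unions over [s] and [l] and a countable
    intersection over [n]. *)
Lemma measurable_dpi_le (r : R) : (0 < N)%N -> 0 < r ->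
  measurable [set z : borel (distmx R N) * borel (distmx R N) |
    dpi_distmx z.1 z.2 <= r].
Proof.
move=> N0 r0.
pose E (s : 'S_N) (n : nat) (l : {set 'I_N}) :
    set (borel (distmx R N) * borel (distmx R N)) :=
  [set z | #|l|%:R < N%:R * (r + n.+1%:R^-1) /\ forall i j, i \notin l ->
    j \notin l -> `|distmx_coef i j z.1 - distmx_coef (s i) (s j) z.2| < r + n.+1%:R^-1].
rewrite (_ : [set _ | _] = \bigcup_(s in [set: 'S_N]) \bigcap_n
    \bigcup_(l in [set: {set 'I_N}]) E s n l); last first.
  apply/seteqP; split=> z /=.
    move=> /dpi_leP[s /dM_leP sr]; exists s => // n _.
    have [_ [l [lr h]]] := sr N0 r0 n; exists l => //; split=> // i j il jl.
    by have := h _ _ il jl; rewrite !mxE.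
  move=> [s _ sr]; apply/dpi_leP; exists s; apply/dM_leP => // n.
  split; first by rewrite addr_gt0.
  have [l _ [lr h]] := sr n I; exists l; split=> // i j il jl.
  by rewrite !mxE; exact: h.
apply: fin_bigcup_measurable => [|s _]; first exact: finite_finset.
apply: bigcapT_measurable => n; apply: fin_bigcup_measurable => [|l _]; first exact: finite_finset.
rewrite /E; set q := r + _.
have [lr|lr] := boolP (#|l|%:R < N%:R * q); last first.
  by rewrite (_ : mkset _ = set0)//; apply/seteqP; split=> // z [].
rewrite (_ : mkset _ = \bigcap_(ij in [set: 'I_N * 'I_N])
    [set z | ij.1 \notin l -> ij.2 \notin l ->
       `|distmx_coef ij.1 ij.2 z.1 - distmx_coef (s ij.1) (s ij.2) z.2| < q]); last first.
  apply/seteqP; split=> z /= h; first by move=> [i j] _ /=; apply: h.2.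
  by split=> // i j; exact: (h (i, j)).
apply: fin_bigcap_measurable => // -[i j] _ /=.
have [il|il] := boolP (i \notin l); last first.
  by rewrite (_ : mkset _ = setT)//; apply/seteqP; split=> // z.
have [jl|jl] := boolP (j \notin l); last first.
  by rewrite (_ : mkset _ = setT)//; apply/seteqP; split=> // z.
pose f (z : borel (distmx R N) * borel (distmx R N)) :=
  `|distmx_coef i j z.1 - distmx_coef (s i) (s j) z.2|.
have mf : measurable_fun setT f.
  apply: measurableT_comp => //; apply: measurable_funB.
    exact: measurableT_comp (measurable_distmx_coef i j) measurable_fst.
  exact: measurableT_comp (measurable_distmx_coef (s i) (s j)) measurable_snd.
rewrite (_ : mkset _ = f @^-1` [set` `]-oo, q[]); last first.
  by apply/seteqP; split=> z /=; rewrite in_itv/=; [move=> /(_ isT isT)|].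
by rewrite -[X in measurable X]setTI; exact: mf.
Qed.

End borel_distmx.

(* The parameter R only serves to attach to bool a metric with values in R. *)
Definition two_points (R : realType) : Type := bool.

(** * The two-point space and its probability measures *)

Section two_points.
Context {R : realType}.

HB.instance Definition _ := Choice.on (two_points R).
HB.instance Definition _ := isPointed.Build (two_points R) false.

Let dist (x y : two_points R) : R := (x != y)%:R.

Let distxx x : dist x x = 0. Proof. by rewrite /dist eqxx. Qed.

Let dist_positivity x y : dist x y = 0 -> x = y.
Proof. by rewrite /dist; case: eqVneq => //= _ /eqP; rewrite oner_eq0. Qed.

Let dist_sym x y : dist x y = dist y x.
Proof. by rewrite /dist eq_sym. Qed.

Let dist_triangle y x z : dist x z <= dist x y + dist y z.
Proof. by rewrite /dist -natrD ler_nat; move: x y z => [] [] []. Qed.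

HB.instance Definition _ := isMetric.Build R (two_points R)
  distxx dist_positivity dist_sym dist_triangle.

Lemma two_points_mdist (x y : two_points R) : mdist x y = (x != y)%:R :> R.
Proof. by []. Qed.

Lemma two_points_compact : compact [set: two_points R].
Proof. by apply: finite_compact; exact: (@finite_finset bool). Qed.

(** Balls of radius 1 are strict, hence singletons, so the topology is discrete. *)
Lemma two_points_open (A : set (two_points R)) : open A.
Proof.
rewrite openE => x Ax; apply/nbhs_ballP; exists 1 => //= y.
rewrite ballEmdist/= two_points_mdist.
by case: eqVneq => [<-|]//=; rewrite ltxx.
Qed.

Lemma two_points_measurable (A : set (borel (two_points R))) : measurable A.
Proof. by apply: sub_sigma_algebra; exact: two_points_open. Qed.

Definition two_points_mm (P : probability (borel (two_points R)) R) :=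
  MMSpace two_points_compact P.

Lemma measurable_to_two_points (f : bool -> borel (two_points R)) :
  measurable_fun [set: bool] f.
Proof. by []. Qed.

Definition two_points_bernoulli (p : R) : probability (borel (two_points R)) R :=
  push_prob (bernoulli_prob p) (measurable_to_two_points (@id bool)).

Lemma two_points_bernoulliE (p : R) A : 0 <= p <= 1 ->
  two_points_bernoulli p A = (p%:E * \d_true A + (1 - p)%:E * \d_false A)%E.
Proof. by move=> p01; rewrite -bernoulli_probE. Qed.

(** The two-point space itself serves as [Z]. The coupling is the law of [(false, b)] with [b]
    Bernoulli of parameter [p], whose coordinates differ only with probability [p]. *)
Lemma dGHP_two_points (p : R) : 0 < p <= 1 ->
  (dGHP (two_points_mm (dirac (false : borel (two_points R))))
        (two_points_mm (two_points_bernoulli p)) <= p%:E)%E.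
Proof.
move=> /andP[p0 p1].
pose f := @IsometricEmbedding R (two_points R) (two_points R) id
  (fun _ _ => erefl).
apply: ge_ereal_inf.
exists (prokhorov (push_prob (dirac (false : borel (two_points R)))
    (measurable_embedding f))
  (push_prob (two_points_bernoulli p) (measurable_embedding f)) mdist).
  by exists (two_points R), f, f; split => //; exact: two_points_compact.
have mg : measurable_fun [set: bool]
  (fun b : bool => (false, b) : borel (two_points R) * borel (two_points R)) by [].
apply: ge_ereal_inf.
exists (coupling_defect (push_prob (bernoulli_prob p) mg) mdist).
  exists (push_prob (bernoulli_prob p) mg) => // A mA.
  split=> //; transitivity (bernoulli_prob p [set _ : bool | A false]) => //.
  transitivity (\d_(false : borel (two_points R)) A : \bar R) => //.
  have [Af|Af] := pselect (A false).
    rewrite diracE mem_set// (_ : mkset _ = setT); first exact: probability_setT.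
    by apply/seteqP; split.
  rewrite diracE memNset// (_ : mkset _ = set0); first exact: measure0.
    by apply/seteqP; split.
apply: ge_ereal_inf; exists p%:E => //; exists p => //; split => //.
set D := [set _ | _].
rewrite [leRHS](_ : _ = bernoulli_prob p [set b : bool | D (false, b)])//.
rewrite bernoulli_probE ?(ltW p0)// !diracE (@mem_set _ _ false); last first.
  by rewrite /D/= two_points_mdist eqxx ltW.
by rewrite mule1 leeDr// mule_ge0// lee_fin ltW.
Qed.

End two_points.

(** * Samples of the two-point space *)

Section sampling_two_points.
Context {R : realType} {N : nat}.

(** For samples of the two-point space, where distances are 0 or 1, this is the event that both
    points are drawn. *)
Definition has_far_pair : set (borel (distmx R N)) :=
  [set A | exists i j, 1 <= distmx_coef i j A].

Lemma measurable_has_far_pair : measurable has_far_pair.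
Proof.
rewrite (_ : has_far_pair = \bigcup_(ij in [set: 'I_N * 'I_N])
    distmx_coef ij.1 ij.2 @^-1` [set` `[1, +oo[]); last first.
  apply/seteqP; split=> [A [i [j Aij]]|A [[i j] _] /=].
    by exists (i, j) => //=; rewrite in_itv/= andbT.
  by rewrite in_itv/= andbT => Aij; exists i, j.
apply: fin_bigcup_measurable => [|ij _]; first exact: finite_finset.
by rewrite -[X in measurable X]setTI; exact: measurable_distmx_coef.
Qed.

Definition zero_distmx : set (borel (distmx R N)) := [set A | val A = 0].

Lemma measurable_zero_distmx : measurable zero_distmx.
Proof.
rewrite (_ : zero_distmx = \bigcap_(ij in [set: 'I_N * 'I_N])
    distmx_coef ij.1 ij.2 @^-1` [set 0]); last first.
  apply/seteqP; split=> [A A0 [i j] _/=|A A0 /=]; first by rewrite /distmx_coef A0 mxE.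
  by apply/matrixP => i j; rewrite mxE; exact: (A0 (i, j)).
apply: fin_bigcap_measurable => [|ij _]; first exact: finite_finset.
by rewrite -[X in measurable X]setTI; exact: measurable_distmx_coef.
Qed.

Lemma power_prob_const (P : probability (borel (two_points R)) R)
    (b : two_points R) :
  power_prob P N [set t | forall i, tnth t i = b] = (P [set b] ^+ N)%E.
Proof.
rewrite (@power_prob_rect _ _ _ P N (fun=> [set b])); last first.
  by move=> _; exact: two_points_measurable.
by rewrite big_const_ord iter_mule mule1.
Qed.

Lemma measurable_const_sample (b : two_points R) :
  measurable [set t : N.-tuple (borel (two_points R)) | forall i, tnth t i = b].
Proof.
rewrite (_ : mkset _ = \bigcap_(i in [set: 'I_N])
    (fun t => tnth t i) @^-1` [set b]); last first.
  by apply/seteqP; split=> t /= h i; [move=> _|]; exact: h.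
apply: fin_bigcap_measurable => [|i _]; first exact: finite_finset.
rewrite -[X in measurable X]setTI; apply: measurable_tnth => //.
exact: two_points_measurable.
Qed.

(** Moves estimates from matrices to samples, where the product structure of [power_prob] is
    available. *)
Lemma theta_le (X : mmspace R) (E : set (borel (distmx R N)))
    (F : set (N.-tuple (borel X))) :
  measurable E -> measurable F -> @sample_distmx R X N @^-1` E `<=` F ->
  (theta X N E <= power_prob (mm_prob X) N F)%E.
Proof.
move=> mE mF EF.
rewrite [leLHS](_ : _ =
  power_prob (mm_prob X) N (@sample_distmx R X N @^-1` E))//.
apply: le_measure => //; apply/mem_set => //.
rewrite -[X in measurable X]setTI.
exact: (measurable_sample_distmx measurableT mE).
Qed.

Lemma theta_dirac_nonzero (b : borel (two_points R)) :
  theta (two_points_mm (dirac b)) N (~` zero_distmx) = 0%E.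
Proof.
pose P : probability (borel (two_points R)) R := dirac b.
pose const := [set t : N.-tuple (borel (two_points R)) | forall i, tnth t i = b].
have mC : measurable (~` const).
  by apply: measurableC; exact: measurable_const_sample.
have const1 : power_prob P N (~` const) = 0%E.
  transitivity (1 - power_prob P N const)%E.
    by apply: probability_setC; exact: measurable_const_sample.
  have -> : power_prob P N const = 1%E; last by rewrite subee.
  transitivity (\d_b [set b] ^+ N : \bar R)%E; first exact: power_prob_const.
  by rewrite diracE mem_set// -EFin_expe expr1n.
apply/eqP; rewrite eq_le measure_ge0 andbT -const1.
apply: (theta_le (two_points_mm P) _ _ (measurableC measurable_zero_distmx) mC).
apply: subsetC => t tb; apply/matrixP => i j.
by rewrite !mxE !tb two_points_mdist eqxx.
Qed.

Lemma theta_no_far_pair (P : probability (borel (two_points R)) R) : (0 < N)%N ->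
  (theta (two_points_mm P) N (~` has_far_pair) <=
     P [set true] ^+ N + P [set false] ^+ N)%E.
Proof.
move=> N0; rewrite -!power_prob_const.
have mc := measurable_const_sample.
apply: le_trans (measureU2 _ (mc true) (mc false)).
apply: (theta_le (two_points_mm P) _ _ (measurableC measurable_has_far_pair)
  (measurableU _ _ (mc true) (mc false))).
(* Without a far pair every draw equals the first one, so the sample is constant. *)
move=> t near_t; have tE i : tnth t i = tnth t (Ordinal N0).
  apply: contrapT => /eqP tiN; apply: near_t; exists i, (Ordinal N0).
  by rewrite /distmx_coef/= mxE two_points_mdist tiN.
by move: tE; case: (tnth t (Ordinal N0)) => tE; [left|right].
Qed.

(** Instance of [prokhorov_ge] for the zero matrix and the matrices with a far pair: [c <= 1 / N]
    controls their distance, and the other bound on [c] controls the mass of the samples that miss a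
    point. *)
Lemma prokhorov_theta_two_points_ge (P : probability (borel (two_points R)) R)
    (b : borel (two_points R)) (c : R) : (0 < N)%N -> c <= N%:R^-1 ->
  (P [set true] ^+ N + P [set false] ^+ N <= (1 - c)%:E)%E ->
  (c%:E <= prokhorov (theta (two_points_mm (dirac b)) N)
             (theta (two_points_mm P) N) dpi_distmx)%E.
Proof.
move=> N0 cN Pc.
apply: (prokhorov_ge _ _ _ zero_distmx has_far_pair).
- by move=> r; exact: measurable_dpi_le.
- exact: measurable_zero_distmx.
- exact: measurable_has_far_pair.
- exact: theta_dirac_nonzero.
- exact: le_trans (theta_no_far_pair _ N0) Pc.
- move=> A B A0 [i [j B1]]; rewrite (le_trans cN)// /dpi_distmx A0.
  exact: dpi0_ge B1.
Qed.

End sampling_two_points.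

(** * Real estimates and the choice of the sample size *)

(** A reciprocal form of Bernoulli's inequality. The induction uses (1 - x)(1 + (n + 1)x) <= 1 +
    nx. *)
Lemma exprn_onem_le (R : realFieldType) (x : R) n : 0 <= x <= 1 ->
  (1 - x) ^+ n * (1 + n%:R * x) <= 1.
Proof.
move=> /andP[x0 x1]; elim: n => [|n IH]; first by rewrite expr0 mul0r addr0 mul1r.
apply: le_trans IH; rewrite exprSr -mulrA ler_wpM2l ?exprn_ge0 ?subr_ge0//.
rewrite -natr1; have n0 : 0 <= n%:R :> R by []. nra.
Qed.

(** The power splits as eps^beta * sqrt eps with [beta > 0], and eps^beta < K once eps <
    K^(1/beta). *)
Lemma powR_lt_mul_sqrt (R : realType) (alpha K : R) : 1 / 2 < alpha -> 0 < K ->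
  exists2 eps0 : R, 0 < eps0 & forall eps, 0 < eps -> eps < eps0 ->
    eps `^ alpha < K * Num.sqrt eps.
Proof.
move=> alpha_gt K0; pose beta := alpha - 2^-1.
have beta0 : 0 < beta by rewrite /beta; lra.
exists (K `^ beta^-1) => [|eps eps0 epsK]; first exact: powR_gt0.
rewrite (_ : alpha = beta + 2^-1); last by rewrite subrK.
rewrite powRD; last by apply/implyP => _; rewrite gt_eqF.
rewrite powR12_sqrt ?ltW// ltr_pM2r ?sqrtr_gt0//.
have -> : K = (K `^ beta^-1) `^ beta by rewrite -powRrM mulVf ?powRr1 ?gt_eqF ?ltW.
by apply: gt0_ltr_powR => //; rewrite nnegrE ltW// powR_gt0.
Qed.

(* N is of order eps^(-1/2), which balances the probability N * eps of seeing
   both points in the sample against the distance 1 / N. *)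
Lemma sample_size (R : realType) (eps : R) : 0 < eps -> eps <= 1 / 36 ->
  exists N : nat, [/\ (0 < N)%N, Num.sqrt eps / 4 <= N%:R^-1 &
    eps ^+ N + (1 - eps) ^+ N <= 1 - Num.sqrt eps / 4].
Proof.
move=> eps0 eps36; set s := Num.sqrt eps.
have s0 : 0 < s by rewrite sqrtr_gt0.
have sE : eps = s ^+ 2 by rewrite sqr_sqrtr// ltW.
have s6 : s <= 1 / 6 by rewrite leNgt; apply/negP => ?; rewrite sE in eps36; nra.
(* This choice gives 1 - s < N * s <= 1, hence N * s >= 5/6 because s <= 1/6. *)
pose N := Num.truncn s^-1.
have /andP[Ns sN] : N%:R <= s^-1 < N.+1%:R by apply: truncn_itv; rewrite invr_ge0 ltW.
have Ns1 : N%:R * s <= 1 by rewrite -ler_pdivlMr// div1r.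
have sN1 : 1 < (N%:R + 1) * s by rewrite natr1 -ltr_pdivrMr// div1r.
have N1 : (1 < N)%N by rewrite -(ltr_nat R); nra.
have N0 : (0 < N)%N by apply: ltnW.
exists N; split=> //.
  by rewrite -[leRHS]div1r ler_pdivlMr ?ltr0n//; lra.
have epsN : eps ^+ N <= s / 12.
  apply: (@le_trans _ _ (eps ^+ 2)); last by rewrite sE; nra.
  by apply: ler_wiXn2l => //; lra.
have q0 : 0 <= (1 - eps) ^+ N by apply: exprn_ge0; lra.
have : (1 - eps) ^+ N * (1 + N%:R * eps) <= 1 by apply: exprn_onem_le; lra.
move: ((1 - eps) ^+ N) q0 => q q0 qx.
have x_ge : 5 / 6 * s <= N%:R * eps by rewrite sE; nra.
(* The term [eps ^+ N] costs s/12, and s/3 - s/12 = s/4. *)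
suff : q <= 1 - s / 3 by lra.
(* Otherwise the product in [qx] would exceed (1 - s/3)(1 + 5s/6) = 1 + s/2 - 5s^2/18 > 1. *)
rewrite leNgt; apply/negP => qs; nra.
Qed.

Theorem theorem7p4 (R : realType) (alpha C : R)
    (C_gt0 : 0 < C) (alpha_gt : 1 / 2 < alpha) (alpha_lt : alpha < 1) :
  exists2 eps0 : R, 0 < eps0 & forall eps : R, 0 < eps -> eps < eps0 ->
    exists X Y : mmspace R, (dGHP X Y <= eps%:E)%E /\
      exists N : nat, (0 < N)%N /\
        ((C * eps `^ alpha)%:E
           < prokhorov (theta X N) (theta Y N) dpi_distmx)%E.
Proof.
(* With K = 1/(4C), eps^alpha < K * sqrt eps becomes C * eps^alpha < sqrt eps / 4, the bound
   supplied by [sample_size]. *)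
have K0 : 0 < C^-1 / 4 by rewrite divr_gt0// invr_gt0.
have [e1 e1_gt0 He1] := powR_lt_mul_sqrt _ _ _ alpha_gt K0.
exists (Num.min e1 (1 / 36)) => [|eps eps0]; first by rewrite lt_min e1_gt0; lra.
rewrite lt_min => /andP[epse1 eps36].
have eps1 : 0 <= eps <= 1 by lra.
exists (two_points_mm (dirac (false : borel (two_points R)))).
exists (two_points_mm (two_points_bernoulli eps)).
split; first by apply: dGHP_two_points; rewrite eps0; lra.
have [N [N0 cN epsN]] := sample_size _ _ eps0 (ltW eps36).
exists N; split=> //.
apply: (@lt_le_trans _ _ (Num.sqrt eps / 4)%:E).
  rewrite lte_fin mulrC -ltr_pdivlMr// (lt_le_trans (He1 _ eps0 epse1))//.
  by rewrite mulrC (mulrC C^-1) mulrA.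
apply: (prokhorov_theta_two_points_ge _ _ _ N0 cN).
rewrite !two_points_bernoulliE// !diracE.
rewrite !classical_sets.in_set1/= !mule1 !mule0 adde0 add0e.
by rewrite -!EFin_expe -EFinD lee_fin.
Qed.
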